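(* Let $r>1$ be real, let $k_r\in(0,1)$ be the singular modulus, $k'_r=\sqrt{1-k_r^2}$, and let $a(r)$ be the elliptic alpha function. For $n\ge0$ let $$B^{(3)}_n=\sum_{j=0}^{n}\left[\binom nj\left(\tfrac12\right)_j\left(\tfrac12\right)_{n-j}\right]^3,$$ and put $$b(r)=\frac{3a(r)+\sqrt r-6a(r)k_r^2-9\sqrt r k_r^2+12\sqrt r k_r^4}{\sqrt r(1-2k_r^2)^2},\qquad c(r)=\frac{3a(r)^2-6a(r)\sqrt r k_r^2-rk_r^2+4rk_r^4}{r(1-2k_r^2)^2}.$$ Then $$\sum_{n=0}^{\infty}\frac{B^{(3)}_n}{(n!)^3}(2k_rk'_r)^{2n}\left(n^2+(b(r)-1)n+c(r)\right)=\frac{3}{(1-2k_r^2)^2\,r\,\pi^2}.$$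
   Context: $K(x)=\int_0^{\pi/2}\frac{dt}{\sqrt{1-x^2\sin^2 t}}$ and $E(x)=\int_0^{\pi/2}\sqrt{1-x^2\sin^2 t}\,dt$. For $r>0$ the singular modulus $k_r\in(0,1)$ is the unique solution $w$ of $K(\sqrt{1-w^2})/K(w)=\sqrt r$. The elliptic alpha function is $a(r)=\frac{\pi}{4K(k_r)^2}-\sqrt r\left(\frac{E(k_r)}{K(k_r)}-1\right)$. $(a)_n=a(a+1)\cdots(a+n-1)$, $(a)_0=1$. *)

(* Defs.v *)
From Stdlib Require Import Reals Arith Factorial.
From Coquelicot Require Import Coquelicot.
Open Scope R_scope.

Definition ellK (x : R) : R :=
  RInt (fun t => / sqrt (1 - x ^ 2 * sin t ^ 2)) 0 (PI / 2).
Definition ellE (x : R) : R :=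
  RInt (fun t => sqrt (1 - x ^ 2 * sin t ^ 2)) 0 (PI / 2).

Definition is_singular_modulus (r k : R) : Prop :=
  0 < k < 1 /\ ellK (sqrt (1 - k ^ 2)) / ellK k = sqrt r.

(* Elliptic alpha function, evaluated at the singular modulus k = k_r. *)
Definition elliptic_alpha (r k : R) : R :=
  PI / (4 * ellK k ^ 2) - sqrt r * (ellE k / ellK k - 1).

Fixpoint poch (a : R) (n : nat) : R :=
  match n with
  | O => 1
  | S m => poch a m * (a + INR m)
  end.

Definition B3 (n : nat) : R :=
  sum_f_R0 (fun j => (Binomial.C n j * poch (1/2) j * poch (1/2) (n - j)) ^ 3) n.

Definition coef_b (r k : R) : R :=
  let a := elliptic_alpha r k in
  (3 * a + sqrt r - 6 * a * k ^ 2 - 9 * sqrt r * k ^ 2 + 12 * sqrt r * k ^ 4)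
  / (sqrt r * (1 - 2 * k ^ 2) ^ 2).

Definition coef_c (r k : R) : R :=
  let a := elliptic_alpha r k in
  (3 * a ^ 2 - 6 * a * sqrt r * k ^ 2 - r * k ^ 2 + 4 * r * k ^ 4)
  / (r * (1 - 2 * k ^ 2) ^ 2).

(* Main.v *)
(* Since [B3 n / (n!)^3] is the self-convolution of [A_n = ((1/2)_n / n!)^3], the series
   is [theta^2 P + (b - 1) theta P + c P] with [P = F^2], [F = sum A_n x^n],
   [theta = x d/dx] and [x = 4 m (1 - m)], [m = k^2]. Clausen's identity gives [F = f^2]
   with [f = 2F1(1/4, 1/4; 1; x)]. As functions of [m], both [f(4 m (1 - m))] and the
   elliptic integral [K] solve [(m (1 - m) y')' = y / 4] and are regular at [m = 0]; their
   Wronskian times [m (1 - m)] is constant, hence zero, so [f(4 m (1 - m)) = 2 K / pi] for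
   [m < 1/2]. The condition [r > 1] puts [k^2] in that range. As [theta f] and [theta^2 f]
   are then expressed through [K] and [E], the result is a rational identity. *)
Require Import Defs.
From Stdlib Require Import Reals Arith Factorial Lra Lia.
From Coquelicot Require Import Coquelicot.
Open Scope R_scope.

(** * Coefficient sequences and Clausen's identity for them *)

Definition poch_quot (s : R) (n : nat) : R := poch s n / INR (fact n).

Lemma poch_quot_S (s : R) (n : nat) :
  INR (S n) * poch_quot s (S n) = (s + INR n) * poch_quot s n.
Proof.
  unfold poch_quot. rewrite fact_simpl, mult_INR. simpl poch. field.
  split; [apply INR_fact_neq_0 | apply not_0_INR; lia].
Qed.

(** The ratio of consecutive terms, [(s + n) / (n + 1)], lies in [[0, 1]] because [0 < s <= 1]. *)
Lemma poch_quot_bounds (s : R) (n : nat) : 0 < s <= 1 -> 0 <= poch_quot s n <= 1.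
Proof.
  intros Hs. induction n as [|n IH].
  - unfold poch_quot. simpl. lra.
  - pose proof (poch_quot_S s n) as H. rewrite S_INR in H.
    pose proof (pos_INR n). nra.
Qed.

(** Coefficients of [2F1(1/4, 1/4; 1; x)]; those of [3F2(1/2, 1/2, 1/2; 1, 1; x)] follow as
    [clausen_A]. *)
Definition clausen_a (n : nat) : R := poch_quot (1/4) n ^ 2.
Definition clausen_A (n : nat) : R := poch_quot (1/2) n ^ 3.

Lemma clausen_a_S (n : nat) :
  INR (S n) ^ 2 * clausen_a (S n) = (1/4 + INR n) ^ 2 * clausen_a n.
Proof. unfold clausen_a. rewrite <- !Rpow_mult_distr, poch_quot_S. reflexivity. Qed.

Lemma clausen_A_S (n : nat) :
  INR (S n) ^ 3 * clausen_A (S n) = (1/2 + INR n) ^ 3 * clausen_A n.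
Proof. unfold clausen_A. rewrite <- !Rpow_mult_distr, poch_quot_S. reflexivity. Qed.

(* Zeilberger certificate: the summand of [(n+1)^3 S_(n+1) - (n+1/2)^3 S_n],
   where [S = PS_mult clausen_a clausen_a], is the forward difference in [j] of
   [j^2 (2j - 3(n+1)) a_j a_(n+1-j)]. *)
Lemma clausen_telescope (n N : nat) :
  (N <= n)%nat ->
  INR (S n) ^ 3 * sum_f_R0 (fun j => clausen_a j * clausen_a (S n - j)) N
  - (1/2 + INR n) ^ 3 * sum_f_R0 (fun j => clausen_a j * clausen_a (n - j)) N
  = INR (S N) ^ 2 * (2 * INR (S N) - 3 * INR (S n))
    * clausen_a (S N) * clausen_a (n - N).
Proof.
  (* With [i] standing for [n - j], the certificate is checked free of truncated subtraction. *)
  assert (step : forall j i : nat,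
    INR (S (j + i)) ^ 3 * (clausen_a j * clausen_a (S i))
    - (1/2 + INR (j + i)) ^ 3 * (clausen_a j * clausen_a i)
    = INR (S j) ^ 2 * (2 * INR (S j) - 3 * INR (S (j + i)))
      * clausen_a (S j) * clausen_a i
      - INR j ^ 2 * (2 * INR j - 3 * INR (S (j + i)))
        * clausen_a j * clausen_a (S i)).
  { intros j i.
    pose proof (clausen_a_S j) as Hj. pose proof (clausen_a_S i) as Hi.
    assert (Hi' : clausen_a (S i)
                  = (1/4 + INR i) ^ 2 / INR (S i) ^ 2 * clausen_a i).
    { apply Rmult_eq_reg_l with (INR (S i) ^ 2).
      - rewrite Hi. field. apply not_0_INR; lia.
      - apply pow_nonzero, not_0_INR; lia. }
    replace (INR (S j) ^ 2 * (2 * INR (S j) - 3 * INR (S (j + i)))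
             * clausen_a (S j) * clausen_a i)
      with ((2 * INR (S j) - 3 * INR (S (j + i)))
            * (INR (S j) ^ 2 * clausen_a (S j)) * clausen_a i) by ring.
    rewrite Hj, Hi'. rewrite !S_INR, plus_INR. field.
    pose proof (pos_INR i); lra. }
  induction N as [|N IH]; intros HN.
  - pose proof (step 0%nat n) as H. simpl (0 + n)%nat in H.
    cbn [sum_f_R0]. rewrite !Nat.sub_0_r.
    (* The lower boundary term vanishes through its factor [INR j ^ 2] at [j = 0]. *)
    rewrite H. rewrite INR_0. ring.
  - cbn [sum_f_R0]. specialize (IH ltac:(lia)).
    pose proof (step (S N) (n - S N)%nat) as H.
    replace (S N + (n - S N))%nat with n in H by lia.
    replace (S (n - S N))%nat with (n - N)%nat in H by lia.
    replace (S n - S N)%nat with (n - N)%nat by lia.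
    lra.
Qed.

(** Both sequences start at 1 and obey the same first-order recurrence, by [clausen_telescope] and
    [clausen_A_S]. *)
Lemma clausen_conv (n : nat) : PS_mult clausen_a clausen_a n = clausen_A n.
Proof.
  induction n as [|n IH].
  - unfold PS_mult, clausen_a, clausen_A, poch_quot. simpl. field.
  - apply Rmult_eq_reg_l with (INR (S n) ^ 3);
      [|apply pow_nonzero, not_0_INR; lia].
    rewrite clausen_A_S, <- IH. unfold PS_mult.
    pose proof (clausen_telescope n n (Nat.le_refl n)) as H.
    rewrite Nat.sub_diag in H. cbn [sum_f_R0]. rewrite Nat.sub_diag.
    rewrite Rmult_plus_distr_l.
    (* The term [j = n + 1] lies outside the telescoped range; it cancels the upper boundary term
       because [2(n+1) - 3(n+1) = -(n+1)]. *)
    replace (INR (S n) ^ 3 * (clausen_a (S n) * clausen_a 0))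
      with (- (INR (S n) ^ 2 * (2 * INR (S n) - 3 * INR (S n))
               * clausen_a (S n) * clausen_a 0)) by ring.
    rewrite <- H. ring.
Qed.

(** Dividing the binomial coefficient by [n!] leaves [1 / (j! (n-j)!)], so each cube splits into a
    factor in [j] and one in [n - j]. *)
Lemma B3_conv (n : nat) : B3 n / INR (fact n) ^ 3 = PS_mult clausen_A clausen_A n.
Proof.
  unfold B3, PS_mult. unfold Rdiv at 1. rewrite Rmult_comm, scal_sum.
  apply sum_eq. intros j Hj. cbv beta.
  unfold clausen_A, poch_quot, Binomial.C. field.
  repeat split; apply INR_fact_neq_0.
Qed.

(** * Power series on the open unit disk *)

(** The strict inequality comes from the midpoint [y] of [Rabs x] and 1: a radius below [y] would
    keep the terms at [y] from tending to 0, against convergence there. *)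
Lemma CV_radius_of_unit_disk (a : nat -> R) :
  (forall x, Rabs x < 1 -> ex_pseries a x) ->
  forall x, Rabs x < 1 -> Rbar_lt (Rabs x) (CV_radius a).
Proof.
  intros Ha x Hx. pose proof (Rabs_pos x).
  set (y := (Rabs x + 1) / 2).
  assert (Hy : Rabs y = y) by (apply Rabs_right; unfold y; lra).
  apply Rbar_lt_le_trans with (Rabs y).
  - rewrite Hy. simpl. unfold y. lra.
  - apply Rbar_not_lt_le. intros Hlt.
    apply (CV_disk_outside _ _ Hlt). apply ex_series_lim_0.
    apply ex_series_ext with (fun n => scal (pow_n y n) (a n)).
    + intros n. rewrite pow_n_pow. apply Rmult_comm.
    + apply Ha. rewrite Hy. unfold y. lra.
Qed.

Lemma CV_radius_of_bounded (a : nat -> R) :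
  (forall n, Rabs (a n) <= 1) ->
  forall x, Rabs x < 1 -> Rbar_lt (Rabs x) (CV_radius a).
Proof.
  intros Ha. apply CV_radius_of_unit_disk. intros x Hx.
  apply (ex_series_le (K := R_AbsRing) (V := R_CompleteNormedModule))
    with (fun n => Rabs x ^ n).
  - intros n. rewrite pow_n_pow. unfold norm; simpl. unfold abs; simpl.
    unfold scal; simpl. unfold mult; simpl. rewrite Rabs_mult, RPow_abs.
    pose proof (Rabs_pos (x ^ n)). pose proof (Ha n). nra.
  - apply ex_series_geom. now rewrite Rabs_Rabsolu.
Qed.

Lemma CV_radius_mult_unit_disk (a b : nat -> R) :
  (forall x, Rabs x < 1 -> Rbar_lt (Rabs x) (CV_radius a)) ->
  (forall x, Rabs x < 1 -> Rbar_lt (Rabs x) (CV_radius b)) ->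
  forall x, Rabs x < 1 -> Rbar_lt (Rabs x) (CV_radius (PS_mult a b)).
Proof.
  intros Ha Hb. apply CV_radius_of_unit_disk. intros x Hx.
  apply ex_pseries_mult; auto.
Qed.

Lemma CV_radius_clausen_a (x : R) : Rabs x < 1 -> Rbar_lt (Rabs x) (CV_radius clausen_a).
Proof.
  apply CV_radius_of_bounded. intros n. unfold clausen_a.
  pose proof (poch_quot_bounds (1/4) n ltac:(lra)).
  rewrite Rabs_right; nra.
Qed.

Lemma CV_radius_clausen_A (x : R) : Rabs x < 1 -> Rbar_lt (Rabs x) (CV_radius clausen_A).
Proof.
  intros Hx. rewrite <- (CV_radius_ext _ _ clausen_conv).
  revert x Hx. apply CV_radius_mult_unit_disk; apply CV_radius_clausen_a.
Qed.

(** * The Euler operator and the hypergeometric equation *)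

(** The operator [theta = x d/dx], acting on coefficients. *)
Definition PS_euler (a : nat -> R) (n : nat) : R := INR n * a n.

Lemma PS_euler_incr_derive (a : nat -> R) (n : nat) :
  PS_incr_1 (PS_derive a) n = PS_euler a n.
Proof. destruct n; unfold PS_euler; simpl; [unfold zero; simpl; ring | reflexivity]. Qed.

Lemma CV_radius_euler (a : nat -> R) : CV_radius (PS_euler a) = CV_radius a.
Proof.
  rewrite <- (CV_radius_ext _ _ (PS_euler_incr_derive a)).
  now rewrite CV_radius_incr_1, CV_radius_derive.
Qed.

Lemma PSeries_euler (a : nat -> R) (x : R) :
  PSeries (PS_euler a) x = x * PSeries (PS_derive a) x.
Proof.
  rewrite <- (PSeries_ext _ _ x (PS_euler_incr_derive a)). apply PSeries_incr_1.
Qed.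

(** The derivative is characterised through the product [x * d], with no division by [x], so that
    the point 0 is included. *)
Lemma is_derive_PSeries_euler (a : nat -> R) (x : R) :
  Rbar_lt (Rabs x) (CV_radius a) ->
  exists d, is_derive (PSeries a) x d /\ PSeries (PS_euler a) x = x * d.
Proof.
  intros Hx. exists (PSeries (PS_derive a) x). split.
  - now apply is_derive_PSeries.
  - apply PSeries_euler.
Qed.

(** [hypf] is [f = 2F1(1/4, 1/4; 1; x)] and [hypg] is [theta f]. *)
Definition hypf (x : R) : R := PSeries clausen_a x.
Definition hypg (x : R) : R := PSeries (PS_euler clausen_a) x.

Lemma hypf_0 : hypf 0 = 1.
Proof. unfold hypf. rewrite PSeries_0. unfold clausen_a, poch_quot. simpl. field. Qed.

Lemma hypg_0 : hypg 0 = 0.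
Proof. unfold hypg. rewrite PSeries_euler. ring. Qed.

Lemma is_derive_hypf (x : R) :
  Rabs x < 1 -> exists d, is_derive hypf x d /\ hypg x = x * d.
Proof. intros Hx. apply is_derive_PSeries_euler. now apply CV_radius_clausen_a. Qed.

(* The hypergeometric equation [theta^2 f = x (theta + 1/4)^2 f]. *)
Lemma is_derive_hypg (x : R) :
  Rabs x < 1 -> is_derive hypg x ((hypg x / 2 + hypf x / 16) / (1 - x)).
Proof.
  intros Hx.
  assert (Hr := CV_radius_clausen_a x Hx).
  assert (Hr1 : Rbar_lt (Rabs x) (CV_radius (PS_euler clausen_a)))
    by now rewrite CV_radius_euler.
  assert (Hr2 : Rbar_lt (Rabs x) (CV_radius (PS_euler (PS_euler clausen_a))))
    by now rewrite CV_radius_euler.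
  assert (H := is_derive_PSeries _ _ Hr1).
  (* The coefficient recurrence with [(n + 1/4)^2 = n^2 + n/2 + 1/16] reads
     [g' = theta g + g/2 + f/16]; then [theta g = x g'] is solved for [g']. *)
  assert (Heq : PSeries (PS_derive (PS_euler clausen_a)) x
    = PSeries (PS_euler (PS_euler clausen_a)) x
      + (hypg x / 2 + hypf x / 16)).
  { unfold hypg, hypf.
    rewrite (PSeries_ext _ (PS_plus (PS_euler (PS_euler clausen_a))
      (PS_plus (PS_scal (/2) (PS_euler clausen_a)) (PS_scal (/16) clausen_a)))).
    - rewrite !PSeries_plus, !PSeries_scal.
      + field.
      + apply ex_pseries_scal; [apply Rmult_comm | now apply CV_radius_inside].
      + apply ex_pseries_scal; [apply Rmult_comm | now apply CV_radius_inside].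
      + now apply CV_radius_inside.
      + apply ex_pseries_plus; (apply ex_pseries_scal;
          [apply Rmult_comm | now apply CV_radius_inside]).
    - intros n. unfold PS_plus, PS_scal, PS_derive, PS_euler.
      unfold plus, scal; simpl plus; simpl scal. unfold mult; simpl mult.
      pose proof (clausen_a_S n) as Hn.
      replace (INR (S n) * (INR (S n) * clausen_a (S n)))
        with (INR (S n) ^ 2 * clausen_a (S n)) by ring.
      rewrite Hn. simpl. unfold mult; simpl. field. }
  rewrite (PSeries_euler (PS_euler clausen_a)) in Heq.
  apply Rabs_def2 in Hx.
  replace ((hypg x / 2 + hypf x / 16) / (1 - x))
    with (PSeries (PS_derive (PS_euler clausen_a)) x); [exact H|].
  apply Rmult_eq_reg_r with (1 - x); [|lra].
  unfold Rdiv at 1. rewrite Rmult_assoc, Rinv_l by lra. lra.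
Qed.

Lemma PSeries_clausen_A (x : R) : Rabs x < 1 -> PSeries clausen_A x = hypf x ^ 2.
Proof.
  intros Hx. rewrite <- (PSeries_ext _ _ x clausen_conv).
  rewrite PSeries_mult by now apply CV_radius_clausen_a.
  unfold hypf. ring.
Qed.

Lemma continuous_ex_derive_R (f : R -> R) (x : R) : ex_derive f x -> continuous f x.
Proof. apply (ex_derive_continuous (K := R_AbsRing) (V := R_NormedModule)). Qed.

(** * Differentiation under the integral sign in the modulus *)

(** Common form of E ([phi] the square root) and K ([phi] its inverse), so that the Leibniz rule is
    proved once for both. *)
Definition modulus_integral (phi : R -> R) (m : R) : R :=
  RInt (fun t => phi (1 - m * sin t ^ 2)) 0 (PI / 2).

Lemma modulus_pos (m t : R) : m < 1 -> 0 < 1 - m * sin t ^ 2.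
Proof.
  intros Hm. pose proof (sin2_cos2 t) as H. unfold Rsqr in H.
  pose proof (pow2_ge_0 (cos t)). pose proof (pow2_ge_0 (sin t)).
  assert (sin t ^ 2 <= 1) by nra.
  destruct (Rle_lt_dec m 0); nra.
Qed.

Lemma continuous_modulus (phi : R -> R) (m t : R) :
  (forall y, 0 < y -> continuous phi y) -> m < 1 ->
  continuous (fun t => phi (1 - m * sin t ^ 2)) t.
Proof.
  intros Hphi Hm. apply (continuous_comp (fun t => 1 - m * sin t ^ 2) phi).
  - apply continuous_ex_derive_R. auto_derive. trivial.
  - now apply Hphi, modulus_pos.
Qed.

Lemma ex_RInt_modulus (phi : R -> R) (m : R) :
  (forall y, 0 < y -> continuous phi y) -> m < 1 ->
  ex_RInt (fun t => phi (1 - m * sin t ^ 2)) 0 (PI / 2).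
Proof.
  intros Hphi Hm. apply (ex_RInt_continuous (V := R_CompleteNormedModule)).
  intros t _. now apply continuous_modulus.
Qed.

Lemma continuous_sin2_modulus (phi : R -> R) (m t : R) :
  (forall y, 0 < y -> continuous phi y) -> m < 1 ->
  continuous (fun t => - sin t ^ 2 * phi (1 - m * sin t ^ 2)) t.
Proof.
  intros Hphi Hm.
  apply (continuous_mult (K := R_AbsRing) (fun t => - sin t ^ 2)
           (fun t => phi (1 - m * sin t ^ 2))).
  - apply continuous_ex_derive_R. auto_derive. trivial.
  - now apply continuous_modulus.
Qed.

Lemma ex_RInt_sin2_modulus (phi : R -> R) (m : R) :
  (forall y, 0 < y -> continuous phi y) -> m < 1 ->
  ex_RInt (fun t => - sin t ^ 2 * phi (1 - m * sin t ^ 2)) 0 (PI / 2).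
Proof.
  intros Hphi Hm. apply (ex_RInt_continuous (V := R_CompleteNormedModule)).
  intros t _. now apply continuous_sin2_modulus.
Qed.

Lemma locally_lt (a x : R) : x < a -> locally x (fun y => y < a).
Proof. apply open_lt. Qed.

Lemma is_derive_modulus_integral (phi dphi : R -> R) (m : R) :
  (forall y, 0 < y -> is_derive phi y (dphi y)) ->
  (forall y, 0 < y -> continuous dphi y) ->
  m < 1 ->
  is_derive (modulus_integral phi) m
    (RInt (fun t => - sin t ^ 2 * dphi (1 - m * sin t ^ 2)) 0 (PI / 2)).
Proof.
  intros Hphi Hdphi Hm.
  assert (Hc : forall y, 0 < y -> continuous phi y).
  { intros y Hy. apply continuous_ex_derive_R. exists (dphi y). now apply Hphi. }
  assert (Hd : forall u t, u < 1 ->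
    is_derive (fun u => phi (1 - u * sin t ^ 2)) u
      (- sin t ^ 2 * dphi (1 - u * sin t ^ 2))).
  { intros u t Hu.
    apply (is_derive_comp phi (fun u => 1 - u * sin t ^ 2)).
    - now apply Hphi, modulus_pos.
    - auto_derive; [trivial | ring]. }
  rewrite <- (RInt_ext (fun t => Derive (fun u => phi (1 - u * sin t ^ 2)) m)).
  2:{ intros t _. apply is_derive_unique. now apply Hd. }
  apply (is_derive_RInt_param (fun u t => phi (1 - u * sin t ^ 2))).
  - apply filter_imp with (fun y => y < 1); [|now apply locally_lt].
    intros u Hu t _. eexists. now apply Hd.
  - intros t _.
    (* The explicit partial derivative is available only for [u < 1], so it replaces [Derive] only
       near [m]. *)
    apply continuity_2d_pt_ext_loc with
      (fun u v => (- sin v ^ 2) * dphi (1 - u * sin v ^ 2)).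
    + destruct (locally_lt 1 m Hm) as [eps Heps]. exists eps.
      intros u v Hu _. symmetry. apply is_derive_unique, Hd.
      now apply Heps.
    + assert (Hs : continuity_2d_pt (fun _ v => sin v ^ 2) m t).
      { apply (continuity_1d_2d_pt_comp (fun v => sin v ^ 2) (fun _ v => v)).
        - apply continuity_pt_filterlim. apply (continuous_ex_derive_R (fun v => sin v ^ 2)).
          auto_derive. trivial.
        - apply continuity_2d_pt_id2. }
      apply continuity_2d_pt_mult; [now apply continuity_2d_pt_opp|].
      apply (continuity_1d_2d_pt_comp dphi (fun u v => 1 - u * sin v ^ 2)).
      * apply continuity_pt_filterlim. now apply Hdphi, modulus_pos.
      * apply continuity_2d_pt_minus; [apply continuity_2d_pt_const|].
        apply continuity_2d_pt_mult; [apply continuity_2d_pt_id1 | exact Hs].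
  - apply filter_imp with (fun y => y < 1); [|now apply locally_lt].
    intros u Hu. now apply ex_RInt_modulus.
Qed.

(* The parameter is [m = k^2], so that [ellK k] is convertible to [Kint (k ^ 2)]. *)
Definition Kint : R -> R := modulus_integral (fun y => / sqrt y).
Definition Eint : R -> R := modulus_integral sqrt.

(** * Derivatives and values of the complete elliptic integrals *)

Lemma is_derive_inv_sqrt (y : R) :
  0 < y -> is_derive (fun y => / sqrt y) y (- / (2 * y * sqrt y)).
Proof.
  intros Hy. pose proof (sqrt_lt_R0 y Hy) as Hs.
  auto_derive; [repeat split; lra|].
  replace (2 * y * sqrt y) with (2 * (sqrt y * sqrt y) * sqrt y)
    by (rewrite sqrt_sqrt; lra).
  field. lra.
Qed.

Lemma continuous_inv_sqrt (y : R) : 0 < y -> continuous (fun y => / sqrt y) y.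
Proof.
  intros Hy. apply continuous_ex_derive_R. eexists. now apply is_derive_inv_sqrt.
Qed.

Lemma ex_RInt_sqrt_modulus (m : R) :
  m < 1 -> ex_RInt (fun t => sqrt (1 - m * sin t ^ 2)) 0 (PI / 2).
Proof.
  intros Hm. apply (ex_RInt_modulus sqrt); [|exact Hm].
  intros y Hy. apply continuous_sqrt.
Qed.

Lemma ex_RInt_inv_sqrt_modulus (m : R) :
  m < 1 -> ex_RInt (fun t => / sqrt (1 - m * sin t ^ 2)) 0 (PI / 2).
Proof.
  intros Hm. apply (ex_RInt_modulus (fun y => / sqrt y)); [|exact Hm].
  apply continuous_inv_sqrt.
Qed.

Lemma is_RInt_lin (f g : R -> R) (a b c d : R) :
  ex_RInt f a b -> ex_RInt g a b ->
  is_RInt (fun t => c * f t + d * g t) a b (c * RInt f a b + d * RInt g a b).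
Proof.
  intros Hf Hg.
  apply (is_RInt_plus (V := R_NormedModule));
    apply (is_RInt_scal (V := R_NormedModule));
    now apply (RInt_correct (V := R_CompleteNormedModule)).
Qed.

Lemma is_derive_sqrt_inv (y : R) : 0 < y -> is_derive sqrt y (/ (2 * sqrt y)).
Proof.
  intros Hy. auto_derive; [exact Hy | field]. apply Rgt_not_eq, sqrt_lt_R0, Hy.
Qed.

Lemma continuous_inv_2sqrt (y : R) : 0 < y -> continuous (fun y => / (2 * sqrt y)) y.
Proof.
  intros Hy. pose proof (sqrt_lt_R0 y Hy). apply continuous_ex_derive_R.
  auto_derive. repeat split; lra.
Qed.

Lemma continuous_inv_ysqrt (y : R) :
  0 < y -> continuous (fun y => - / (2 * y * sqrt y)) y.
Proof.
  intros Hy. pose proof (sqrt_lt_R0 y Hy). apply continuous_ex_derive_R.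
  auto_derive. repeat split; nra.
Qed.

(** Already true of the integrands: for [s = sqrt (1 - m sin^2 t)], [s - 1/s = - m sin^2 t / s].
    Keeping the factor [2 * m] on the left covers [m = 0]. *)
Lemma is_derive_Eint (m : R) :
  m < 1 -> exists d, is_derive Eint m d /\ 2 * m * d = Eint m - Kint m.
Proof.
  intros Hm. eexists. split.
  - apply (is_derive_modulus_integral sqrt (fun y => / (2 * sqrt y))); [| |exact Hm].
    + apply is_derive_sqrt_inv.
    + apply continuous_inv_2sqrt.
  - set (h := fun t => - sin t ^ 2 * / (2 * sqrt (1 - m * sin t ^ 2))).
    assert (Hh : ex_RInt h 0 (PI / 2))
      by now apply (ex_RInt_sin2_modulus _ m continuous_inv_2sqrt).
    transitivity (RInt (fun t => 2 * m * h t) 0 (PI / 2)).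
    { symmetry. apply is_RInt_unique. apply (is_RInt_scal (V := R_NormedModule)).
      now apply (RInt_correct (V := R_CompleteNormedModule)). }
    apply is_RInt_unique.
    replace (Eint m - Kint m) with (1 * Eint m + (-1) * Kint m) by ring.
    apply (is_RInt_ext (fun t => 1 * sqrt (1 - m * sin t ^ 2)
             + (-1) * / sqrt (1 - m * sin t ^ 2))).
    + intros t _. unfold h.
      pose proof (modulus_pos m t Hm) as Hp.
      pose proof (sqrt_lt_R0 _ Hp). pose proof (sqrt_sqrt _ (Rlt_le _ _ Hp)) as Hq.
      set (s := sqrt (1 - m * sin t ^ 2)) in *.
      change (@eq R (1 * s + -1 * / s) (2 * m * (- sin t ^ 2 * / (2 * s)))).
      transitivity ((s * s - 1) * / s); [field; lra | rewrite Hq; field; lra].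
    + apply is_RInt_lin; [now apply ex_RInt_sqrt_modulus | now apply ex_RInt_inv_sqrt_modulus].
Qed.

(** In contrast to [is_derive_Eint], the integrands of the two sides agree only up to an exact
    derivative. *)
Lemma is_derive_Kint (m : R) :
  m < 1 ->
  exists d, is_derive Kint m d /\ 2 * m * (1 - m) * d = Eint m - (1 - m) * Kint m.
Proof.
  intros Hm. eexists. split.
  - apply (is_derive_modulus_integral (fun y => / sqrt y)
             (fun y => - / (2 * y * sqrt y))); [| |exact Hm].
    + apply is_derive_inv_sqrt.
    + apply continuous_inv_ysqrt.
  - set (D := fun t => 1 - m * sin t ^ 2).
    set (h := fun t => - sin t ^ 2 * - / (2 * D t * sqrt (D t))).
    assert (HD : forall t, 0 < D t) by (intros t; now apply modulus_pos).
    assert (Hs : forall t, 0 < sqrt (D t)) by (intros t; now apply sqrt_lt_R0).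
    assert (Hq : forall t, sqrt (D t) * sqrt (D t) = D t)
      by (intros t; now apply sqrt_sqrt, Rlt_le).
    assert (Hh : ex_RInt h 0 (PI / 2))
      by now apply (ex_RInt_sin2_modulus _ m continuous_inv_ysqrt).
    (* The integrand of the difference of the two sides is [m] times the derivative of
       [sin t cos t / sqrt (D t)], which vanishes at both endpoints. *)
    set (q := fun t => sin t * cos t / sqrt (D t)).
    set (dq := fun t => (1 * sqrt (D t) + (- (1 - m)) * / sqrt (D t))
                        + (- (2 * m * (1 - m))) * h t).
    assert (Hdq : forall t, is_derive (fun t => m * q t) t (dq t)).
    { intros t. pose proof (HD t). pose proof (Hs t). pose proof (Hq t) as Hqt.
      assert (HE : 1 + - (m * (sin t * (sin t * 1))) = D t) by (unfold D; ring).
      unfold q, dq, h. unfold D at 1.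
      auto_derive; rewrite HE; [repeat split; lra|].
      replace (1 - m * sin t ^ 2) with (D t) by reflexivity.
      set (s := sqrt (D t)) in *.
      assert (Hcos : cos t ^ 2 = 1 - sin t ^ 2)
        by (pose proof (sin2_cos2 t) as H1; unfold Rsqr in H1; lra).
      assert (Hs2 : s ^ 2 = 1 - m * sin t ^ 2) by (simpl; rewrite Rmult_1_r; exact Hqt).
      rewrite <- Hqt. field_simplify_eq; [|lra].
      replace (s ^ 4) with ((s ^ 2) ^ 2) by ring.
      rewrite !Hcos, !Hs2. ring. }
    assert (H0 : is_RInt dq 0 (PI / 2) (minus (m * q (PI / 2)) (m * q 0))).
    { apply (is_RInt_derive (V := R_CompleteNormedModule) (fun t => m * q t) dq).
      - intros t _. apply Hdq.
      - intros t _. unfold dq.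
        apply (continuous_plus (V := R_NormedModule)); [apply (continuous_plus (V := R_NormedModule))|].
        + apply (continuous_scal_r (V := R_NormedModule) 1 (fun t => sqrt (D t))).
          apply (continuous_modulus sqrt); [|exact Hm]. intros y _. apply continuous_sqrt.
        + apply (continuous_scal_r (V := R_NormedModule) _ (fun t => / sqrt (D t))).
          now apply (continuous_modulus (fun y => / sqrt y) _ _ continuous_inv_sqrt).
        + apply (continuous_scal_r (V := R_NormedModule) _ h).
          now apply (continuous_sin2_modulus _ _ _ continuous_inv_ysqrt). }
    replace (minus (m * q (PI / 2)) (m * q 0)) with 0 in H0.
    2:{ unfold q, minus, plus, opp; simpl. rewrite sin_PI2, cos_PI2, sin_0, cos_0.
        unfold Rdiv. ring. }
    (* The same integral computed by linearity; [H0] gives it the value 0 by the fundamental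
       theorem. *)
    assert (H1 : is_RInt dq 0 (PI / 2)
       ((1 * Eint m + (- (1 - m)) * Kint m) + (- (2 * m * (1 - m))) * RInt h 0 (PI / 2))).
    { apply (is_RInt_plus (V := R_NormedModule)).
      - apply is_RInt_lin; [now apply ex_RInt_sqrt_modulus | now apply ex_RInt_inv_sqrt_modulus].
      - apply (is_RInt_scal (V := R_NormedModule)).
        now apply (RInt_correct (V := R_CompleteNormedModule)). }
    apply (is_RInt_unique (V := R_CompleteNormedModule)) in H0, H1.
    change (2 * m * (1 - m) * RInt h 0 (PI / 2) = Eint m - (1 - m) * Kint m).
    rewrite H0 in H1. lra.
Qed.

Lemma Kint_pos (m : R) : m < 1 -> 0 < Kint m.
Proof.
  intros Hm. apply RInt_gt_0.
  - pose proof PI_RGT_0. lra.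
  - intros t _. now apply Rinv_0_lt_compat, sqrt_lt_R0, modulus_pos.
  - intros t _. apply (continuous_modulus (fun y => / sqrt y)); [|exact Hm].
    apply continuous_inv_sqrt.
Qed.

Lemma Kint_incr (m n : R) : m <= n -> n < 1 -> Kint m <= Kint n.
Proof.
  intros Hmn Hn. apply RInt_le.
  - pose proof PI_RGT_0. lra.
  - apply ex_RInt_inv_sqrt_modulus. lra.
  - now apply ex_RInt_inv_sqrt_modulus.
  - intros t _. pose proof (modulus_pos n t Hn).
    apply Rinv_le_contravar; [now apply sqrt_lt_R0 | apply sqrt_le_1_alt].
    pose proof (pow2_ge_0 (sin t)). nra.
Qed.

Lemma Kint_0 : Kint 0 = PI / 2.
Proof.
  unfold Kint, modulus_integral.
  rewrite (RInt_ext _ (fun _ => 1)).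
  - rewrite RInt_const. unfold scal; simpl; unfold mult; simpl. ring.
  - intros t _. rewrite Rmult_0_l, Rminus_0_r, sqrt_1. apply Rinv_1.
Qed.

Lemma Eint_0 : Eint 0 = PI / 2.
Proof.
  unfold Eint, modulus_integral.
  rewrite (RInt_ext _ (fun _ => 1)).
  - rewrite RInt_const. unfold scal; simpl; unfold mult; simpl. ring.
  - intros t _. rewrite Rmult_0_l, Rminus_0_r. apply sqrt_1.
Qed.

(** * Identification of [f(4 m (1 - m))] with [2 K / pi] *)

(** At [m = 0] the relations for the derivatives carry a vanishing factor and do not determine them;
    there only differentiability is asked, for continuity in the mean value theorem. *)
Lemma eq_of_derive_zero_inside (f : R -> R) (a b : R) :
  a < b ->
  (forall u, a <= u <= b -> exists d, is_derive f u d /\ (a < u -> d = 0)) ->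
  f b = f a.
Proof.
  intros Hab Hf.
  destruct (MVT_gen f a b (fun _ => 0)) as [c [_ Hc]].
  - rewrite Rmin_left, Rmax_right by lra. intros u Hu.
    destruct (Hf u) as [d [Hd H0]]; [lra|]. now rewrite H0 in Hd.
  - rewrite Rmin_left, Rmax_right by lra. intros u Hu.
    destruct (Hf u Hu) as [d [Hd _]].
    apply continuity_pt_filterlim, continuous_ex_derive_R. now exists d.
  - lra.
Qed.

Lemma Rabs_quadratic_lt_1 (m : R) : 0 <= m < 1/2 -> Rabs (4 * m * (1 - m)) < 1.
Proof. intros Hm. rewrite Rabs_right; nra. Qed.

(** Chain rule with [dx/dm = 4 (1 - 2m)]: for [y = f(4 m (1 - m))], the regular expression
    [(1 - 2m) g] represents [m (1 - m) y']. *)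
Lemma is_derive_hypf_quadratic (m : R) :
  0 <= m < 1/2 ->
  exists d, is_derive (fun u => hypf (4 * u * (1 - u))) m d
            /\ m * (1 - m) * d = (1 - 2 * m) * hypg (4 * m * (1 - m)).
Proof.
  intros Hm. pose proof (Rabs_quadratic_lt_1 m Hm) as Hx.
  destruct (is_derive_hypf _ Hx) as [d [Hd Hg]].
  exists ((4 - 8 * m) * d). split.
  - apply (is_derive_comp hypf (fun u => 4 * u * (1 - u))); [exact Hd|].
    auto_derive; [trivial | ring].
  - rewrite Hg. ring.
Qed.

(** This is [(m (1 - m) y')' = y / 4] for that [y]; the denominator cancels because
    [1 - 4m(1 - m) = (1 - 2m)^2]. *)
Lemma is_derive_hypg_quadratic (m : R) :
  0 <= m < 1/2 ->
  is_derive (fun u => (1 - 2 * u) * hypg (4 * u * (1 - u))) m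
    (hypf (4 * m * (1 - m)) / 4).
Proof.
  intros Hm. pose proof (Rabs_quadratic_lt_1 m Hm) as Hx.
  pose proof (is_derive_hypg _ Hx) as Hd.
  assert (Hc : is_derive (fun u => hypg (4 * u * (1 - u))) m
     ((4 - 8 * m) * ((hypg (4 * m * (1 - m)) / 2 + hypf (4 * m * (1 - m)) / 16)
                     / (1 - 4 * m * (1 - m))))).
  { apply (is_derive_comp hypg (fun u => 4 * u * (1 - u))); [exact Hd|].
    auto_derive; [trivial | ring]. }
  assert (Hl : is_derive (fun u => 1 - 2 * u) m (-2)) by (auto_derive; [trivial | ring]).
  pose proof (Derive.is_derive_mult _ _ m _ _ Hl Hc) as H. cbv beta in H.
  match type of H with is_derive _ _ ?l =>
    replace (hypf (4 * m * (1 - m)) / 4) with l; [exact H|] end.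
  field. apply Rgt_not_eq. nra.
Qed.

(** By [is_derive_Kint] the differentiated function is [m (1 - m) K'], so K satisfies the same
    equation. *)
Lemma is_derive_Legendre (m : R) :
  m < 1 ->
  exists d, is_derive (fun u => (Eint u - (1 - u) * Kint u) / 2) m d
            /\ (m <> 0 -> d = Kint m / 4).
Proof.
  intros Hm.
  destruct (is_derive_Eint m Hm) as [dE [HE E1]].
  destruct (is_derive_Kint m Hm) as [dK [HK K1]].
  exists ((dE + Kint m - (1 - m) * dK) / 2). split.
  - auto_derive; [split; [now exists dE | split; [now exists dK | trivial]]|].
    rewrite (is_derive_unique (fun u : R => Eint u) m dE HE).
    rewrite (is_derive_unique (fun u : R => Kint u) m dK HK). field.
  - intros H0. apply Rmult_eq_reg_l with (4 * m); [|lra].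
    replace (4 * m * ((dE + Kint m - (1 - m) * dK) / 2))
      with (2 * m * dE + 2 * m * Kint m - 2 * m * (1 - m) * dK) by field.
    rewrite E1, K1. field.
Qed.

(** The difference of the sides is [m (1 - m) (K' y - K y')], written without derivatives. It is
    constant by the common equation, and zero at 0 since [E(0) = K(0)] and [g(0) = 0]. *)
Lemma Wronskian_hypf_Kint (m : R) :
  0 < m < 1/2 ->
  (Eint m - (1 - m) * Kint m) / 2 * hypf (4 * m * (1 - m))
  = (1 - 2 * m) * hypg (4 * m * (1 - m)) * Kint m.
Proof.
  intros Hm.
  set (W := fun u => (Eint u - (1 - u) * Kint u) / 2 * hypf (4 * u * (1 - u))
                     - (1 - 2 * u) * hypg (4 * u * (1 - u)) * Kint u).
  enough (H : W m = W 0).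
  { unfold W in H. rewrite Kint_0, Eint_0 in H.
    replace (4 * 0 * (1 - 0)) with 0 in H by ring. rewrite hypg_0 in H. lra. }
  apply eq_of_derive_zero_inside; [lra|]. intros u Hu.
  assert (Hu1 : u < 1) by lra. assert (Hu2 : 0 <= u < 1/2) by lra.
  destruct (is_derive_Kint u Hu1) as [dK [HK K1]].
  destruct (is_derive_Legendre u Hu1) as [dL [HL L1]].
  destruct (is_derive_hypf_quadratic u Hu2) as [df [Hf f1]].
  pose proof (is_derive_hypg_quadratic u Hu2) as Hg.
  pose proof (Derive.is_derive_mult _ _ u _ _ HL Hf) as H1.
  pose proof (Derive.is_derive_mult _ _ u _ _ Hg HK) as H2.
  eexists. split.
  - apply (is_derive_minus (V := R_NormedModule) _ _ u _ _ H1 H2).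
  - intros Hpos. unfold minus, plus, opp; simpl.
    rewrite L1 by lra. set (f := hypf (4 * u * (1 - u))) in *.
    set (g := hypg (4 * u * (1 - u))) in *.
    apply Rmult_eq_reg_l with (u * (1 - u)); [|nra].
    replace (u * (1 - u) * (Kint u / 4 * f + (Eint u - (1 - u) * Kint u) / 2 * df
               + - (f / 4 * Kint u + (1 - 2 * u) * g * dK)))
      with ((Eint u - (1 - u) * Kint u) / 2 * (u * (1 - u) * df)
            - (1 - 2 * u) * g * (2 * u * (1 - u) * dK) / 2) by field.
    rewrite K1, f1. field.
Qed.

(** The vanishing Wronskian makes [y / K] constant, and its value at 0 is [1 / (pi / 2)]. *)
Lemma hypf_quadratic (m : R) :
  0 < m < 1/2 -> hypf (4 * m * (1 - m)) = 2 * Kint m / PI.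
Proof.
  intros Hm. pose proof PI_RGT_0 as Hpi.
  set (Q := fun u => hypf (4 * u * (1 - u)) / Kint u).
  pose proof (Kint_pos m ltac:(lra)) as HKm.
  enough (H : Q m = Q 0).
  { unfold Q in H. rewrite Kint_0 in H.
    replace (4 * 0 * (1 - 0)) with 0 in H by ring. rewrite hypf_0 in H.
    replace (hypf (4 * m * (1 - m)))
      with (hypf (4 * m * (1 - m)) / Kint m * Kint m) by (field; lra).
    rewrite H. field. lra. }
  apply eq_of_derive_zero_inside; [lra|]. intros u Hu.
  assert (Hu1 : u < 1) by lra. assert (Hu2 : 0 <= u < 1/2) by lra.
  pose proof (Kint_pos u Hu1) as HKu.
  destruct (is_derive_Kint u Hu1) as [dK [HK K1]].
  destruct (is_derive_hypf_quadratic u Hu2) as [df [Hf f1]].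
  eexists. split.
  - apply (is_derive_div _ _ u _ _ Hf HK). lra.
  - intros Hpos. pose proof (Wronskian_hypf_Kint u ltac:(lra)) as HW.
    apply Rmult_eq_reg_l with (u * (1 - u)); [|nra].
    replace (u * (1 - u) * ((df * Kint u - hypf (4 * u * (1 - u)) * dK) / Kint u ^ 2))
      with ((u * (1 - u) * df * Kint u
             - (2 * u * (1 - u) * dK) / 2 * hypf (4 * u * (1 - u))) / Kint u ^ 2)
      by (field; lra).
    rewrite f1, K1, <- HW. field. lra.
Qed.

Lemma hypg_quadratic (m : R) :
  0 < m < 1/2 ->
  hypg (4 * m * (1 - m)) = (Eint m - (1 - m) * Kint m) / (PI * (1 - 2 * m)).
Proof.
  intros Hm. pose proof (Wronskian_hypf_Kint m Hm) as H.
  pose proof (Kint_pos m ltac:(lra)). pose proof PI_RGT_0.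
  rewrite hypf_quadratic in H by exact Hm.
  apply Rmult_eq_reg_l with ((1 - 2 * m) * Kint m); [|nra].
  replace ((1 - 2 * m) * Kint m * hypg (4 * m * (1 - m)))
    with ((1 - 2 * m) * hypg (4 * m * (1 - m)) * Kint m) by ring.
  rewrite <- H. field. lra.
Qed.

(** * The series with coefficients [B3 n / (n!)^3] *)

Definition clausen_C : nat -> R := PS_mult clausen_A clausen_A.

Lemma CV_radius_clausen_C (x : R) : Rabs x < 1 -> Rbar_lt (Rabs x) (CV_radius clausen_C).
Proof. revert x. apply CV_radius_mult_unit_disk; apply CV_radius_clausen_A. Qed.

Lemma PSeries_clausen_C (x : R) : Rabs x < 1 -> PSeries clausen_C x = hypf x ^ 4.
Proof.
  intros Hx. unfold clausen_C.
  rewrite PSeries_mult by now apply CV_radius_clausen_A.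
  rewrite PSeries_clausen_A by exact Hx. ring.
Qed.

Lemma locally_unit_disk (x : R) : Rabs x < 1 -> locally x (fun y => Rabs y < 1).
Proof.
  intros Hx. apply (open_comp (fun y => Rabs y) (fun z => z < 1)); [|apply open_lt|exact Hx].
  intros y _. apply continuous_Rabs.
Qed.

(** Lets [theta] be applied to a closed form of the sum: the series and [F] agree near [x], hence
    have the same derivative there. *)
Lemma PSeries_euler_of_derive (a : nat -> R) (F : R -> R) (x d : R) :
  (forall y, Rabs y < 1 -> Rbar_lt (Rabs y) (CV_radius a)) ->
  (forall y, Rabs y < 1 -> PSeries a y = F y) ->
  Rabs x < 1 -> is_derive F x d -> PSeries (PS_euler a) x = x * d.
Proof.
  intros Ha HF Hx Hd. rewrite PSeries_euler. f_equal.
  rewrite <- Derive_PSeries by now apply Ha.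
  rewrite (Derive_ext_loc _ F); [now apply is_derive_unique|].
  apply filter_imp with (fun y => Rabs y < 1); [exact HF | now apply locally_unit_disk].
Qed.

Lemma PSeries_euler_clausen_C (x : R) :
  Rabs x < 1 -> PSeries (PS_euler clausen_C) x = 4 * (hypf x ^ 3 * hypg x).
Proof.
  intros Hx. destruct (is_derive_hypf x Hx) as [d [Hd Hg]].
  rewrite (PSeries_euler_of_derive clausen_C (fun y => hypf y ^ 4) x
             (INR 4 * d * hypf x ^ 3));
    [ | apply CV_radius_clausen_C | apply PSeries_clausen_C | exact Hx
      | exact (is_derive_pow hypf 4 x d Hd)].
  rewrite Hg. simpl. ring.
Qed.

(** Product rule for [theta (4 f^3 g)], with [theta f = g] and [theta g = x g'] taken from the
    hypergeometric equation. *)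
Lemma PSeries_euler2_clausen_C (x : R) :
  Rabs x < 1 ->
  PSeries (PS_euler (PS_euler clausen_C)) x
  = 12 * hypf x ^ 2 * hypg x ^ 2
    + 4 * hypf x ^ 3 * (x * (hypg x / 2 + hypf x / 16) / (1 - x)).
Proof.
  intros Hx. destruct (is_derive_hypf x Hx) as [d [Hd Hg]].
  pose proof (is_derive_hypg x Hx) as Hdg.
  erewrite (PSeries_euler_of_derive (PS_euler clausen_C)
              (fun y => 4 * (hypf y ^ 3 * hypg y)) x);
    [ | intros y Hy; rewrite CV_radius_euler; now apply CV_radius_clausen_C
      | apply PSeries_euler_clausen_C | exact Hx
      | apply is_derive_scal; exact (Derive.is_derive_mult _ _ x _ _ (is_derive_pow hypf 3 x d Hd) Hdg)].
  apply Rabs_def2 in Hx. cbn [INR Init.Nat.pred].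
  transitivity (12 * hypf x ^ 2 * hypg x * (x * d)
    + 4 * hypf x ^ 3 * (x * (hypg x / 2 + hypf x / 16) / (1 - x))).
  - field. lra.
  - rewrite <- Hg. ring.
Qed.

Lemma is_series_clausen_quadratic (x b c : R) :
  Rabs x < 1 ->
  is_series (fun n => clausen_C n * x ^ n * (INR n ^ 2 + b * INR n + c))
    (PSeries (PS_euler (PS_euler clausen_C)) x + b * PSeries (PS_euler clausen_C) x
     + c * PSeries clausen_C x).
Proof.
  intros Hx. pose proof (CV_radius_clausen_C x Hx) as H0.
  assert (Hs : forall a, Rbar_lt (Rabs x) (CV_radius a) ->
             is_series (fun n => a n * x ^ n) (PSeries a x)).
  { intros a Ha. apply is_pseries_R, PSeries_correct. now apply CV_radius_inside. }
  pose proof (Hs _ H0) as S0.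
  pose proof (Hs (PS_euler clausen_C) ltac:(now rewrite CV_radius_euler)) as S1.
  pose proof (Hs (PS_euler (PS_euler clausen_C)) ltac:(now rewrite !CV_radius_euler)) as S2.
  apply (is_series_scal_l b) in S1. apply (is_series_scal_l c) in S0.
  eapply is_series_ext;
    [|exact (is_series_plus _ _ _ _ (is_series_plus _ _ _ _ S2 S1) S0)].
  intros n. unfold plus, scal; simpl. unfold mult; simpl. unfold PS_euler. ring.
Qed.

(** * The singular modulus and the final identity *)

(** If [k^2 >= 1/2] then [1 - k^2 <= k^2], and monotonicity of K makes the ratio at most 1, below
    [sqrt r]. *)
Lemma singular_modulus_lt (r k : R) : 1 < r -> is_singular_modulus r k -> k ^ 2 < 1/2.
Proof.
  intros Hr [Hk Hw]. apply Rnot_le_lt. intros Hle.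
  pose proof (Kint_pos (k ^ 2) ltac:(nra)) as HK.
  assert (H1 : 1 < sqrt r) by (rewrite <- sqrt_1; apply sqrt_lt_1; lra).
  assert (H2 : ellK (sqrt (1 - k ^ 2)) = Kint (1 - k ^ 2)).
  { change (Kint (sqrt (1 - k ^ 2) ^ 2) = Kint (1 - k ^ 2)).
    f_equal. apply pow2_sqrt. nra. }
  rewrite H2 in Hw. change (ellK k) with (Kint (k ^ 2)) in Hw.
  assert (Kint (1 - k ^ 2) <= Kint (k ^ 2)) by (apply Kint_incr; nra).
  assert (Kint (1 - k ^ 2) = sqrt r * Kint (k ^ 2)) by (rewrite <- Hw; field; lra).
  nra.
Qed.

Theorem theorem2p3 (r k : R) (hr : 1 < r) (hk : is_singular_modulus r k) :
  is_series
    (fun n : nat =>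
       B3 n / INR (fact n) ^ 3 * (2 * k * sqrt (1 - k ^ 2)) ^ (2 * n)
       * (INR n ^ 2 + (coef_b r k - 1) * INR n + coef_c r k))
    (3 / ((1 - 2 * k ^ 2) ^ 2 * r * PI ^ 2)).
Proof.
  pose proof (singular_modulus_lt r k hr hk) as Hm2.
  destruct hk as [Hk _].
  assert (Hm : 0 < k ^ 2 < 1/2) by (split; [nra | exact Hm2]).
  pose proof (Rabs_quadratic_lt_1 (k ^ 2) ltac:(lra)) as Hx.
  assert (Hy : (2 * k * sqrt (1 - k ^ 2)) ^ 2 = 4 * k ^ 2 * (1 - k ^ 2)).
  { rewrite Rpow_mult_distr, pow2_sqrt by lra. ring. }
  apply is_series_ext with
    (fun n => clausen_C n * (4 * k ^ 2 * (1 - k ^ 2)) ^ n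
              * (INR n ^ 2 + (coef_b r k - 1) * INR n + coef_c r k)).
  { intros n. now rewrite pow_mult, Hy, B3_conv. }
  pose proof (is_series_clausen_quadratic _ (coef_b r k - 1) (coef_c r k) Hx) as H.
  rewrite PSeries_euler2_clausen_C, PSeries_euler_clausen_C, PSeries_clausen_C in H
    by exact Hx.
  rewrite hypf_quadratic, hypg_quadratic in H by exact Hm.
  match type of H with is_series _ ?l =>
    replace (3 / ((1 - 2 * k ^ 2) ^ 2 * r * PI ^ 2)) with l; [exact H|] end.
  clear H. unfold coef_b, coef_c, elliptic_alpha.
  change (ellK k) with (Kint (k ^ 2)). change (ellE k) with (Eint (k ^ 2)).
  pose proof (Kint_pos (k ^ 2) ltac:(lra)) as HK.
  pose proof PI_RGT_0 as Hpi.
  assert (HR : 0 < sqrt r) by (apply sqrt_lt_R0; lra).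
  (* With [r] written as a square, the goal becomes a rational identity in [sqrt r], K, E, [m = k^2]
     and [PI]. *)
  assert (Hr : r = sqrt r * sqrt r) by (symmetry; apply sqrt_sqrt; lra).
  set (R0 := sqrt r) in *. set (K := Kint (k ^ 2)) in *. set (E := Eint (k ^ 2)).
  clearbody R0 K E. rewrite Hr.
  replace (k ^ 4) with ((k ^ 2) ^ 2) by ring.
  set (m := k ^ 2) in *. clearbody m.
  field.
  repeat split; try apply Rgt_not_eq; nra.
Qed.
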